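(* Let $\mathbf{M}\in\mathcal{A}$ and let $\mathbf{L}\in\mathcal{B}$ be an $n\times n$ doubly stochastic matrix. Then $\mathbf{M}\in\Phi^{-1}(\mathbf{L})$ if and only if $\mathbf{M}$ is cross ratio equivalent to $\mathbf{L}$.
   Context: All matrices are real, non-negative and have no zero rows or zero columns. For an $n\times n$ matrix $A=(a_{ij})$ and a permutation $\sigma\in S_n$, the set $\{a_{1,\sigma(1)},\dots,a_{n,\sigma(n)}\}$ is the diagonal of $A$ determined by $\sigma$; it is positive if all $a_{i,\sigma(i)}>0$. $\mathcal{A}$ is the set of $n\times n$ matrices that have at least one positive diagonal, and $\mathcal{B}$ is the set of $n\times n$ doubly stochastic matrices. Sinkhorn (SK) iteration of $\mathbf{M}$ alternately normalizes rows (dividing each row by its sum) and columns (dividing each column by its sum), starting with rows. By Sinkhorn and Knopp, for $\mathbf{M}\in\mathcal{A}$ it converges to a unique $\mathbf{M}^*\in\mathcal{B}$; $\Phi:\mathcal{A}\to\mathcal{B}$ is the map $\Phi(\mathbf{M})=\mathbf{M}^*$, and $\Phi^{-1}(\mathbf{L})=\{\mathbf{M}\in\mathcal{A}:\Phi(\mathbf{M})=\mathbf{L}\}$. Cross ratio equivalence: for $\sigma\in S_n$ put $d^A_\sigma=\prod_{i=1}^n a_{i,\sigma(i)}$. If $\sigma,\sigma'$ determine positive diagonals of $A$, the cross ratio between them is $d^A_\sigma/d^A_{\sigma'}$. Two $n\times n$ matrices $A,B$ are cross ratio equivalent, $A\overset{cr}{\sim}B$, if for every $\sigma\in S_n$,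 $d^A_\sigma\neq0\Longleftrightarrow d^B_\sigma\neq 0$, and $d^A_\sigma/d^A_{\sigma'}=d^B_\sigma/d^B_{\sigma'}$ for all $\sigma,\sigma'\in S_n$ determining positive diagonals of $A$. *)

(* Defs.v *)
From mathcomp Require Import all_boot all_order all_fingroup all_algebra.
From mathcomp Require Import all_classical all_reals all_analysis.
Set Implicit Arguments.
Unset Strict Implicit.
Unset Printing Implicit Defensive.
Import Order.TTheory GRing.Theory Num.Theory.
Import numFieldNormedType.Exports.
Local Open Scope classical_set_scope.
Local Open Scope ring_scope.

Section Sinkhorn.
Context {R : realType} {n : nat}.
Implicit Types (A B M L : 'M[R]_n) (s t : 'S_n).

Definition nonneg_no_zero_line A : Prop :=
  [/\ forall i j, 0 <= A i j,
      forall i, exists j, A i j != 0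
    & forall j, exists i, A i j != 0].

Definition positive_diag A s : Prop := forall i, 0 < A i (s i).

Definition calA : set 'M[R]_n :=
  [set A | nonneg_no_zero_line A /\ exists s, positive_diag A s].

Definition calB : set 'M[R]_n :=
  [set B | [/\ nonneg_no_zero_line B,
               forall i, \sum_j B i j = 1
             & forall j, \sum_i B i j = 1]].

Definition row_normalize A : 'M[R]_n := \matrix_(i, j) (A i j / \sum_k A i k).

Definition col_normalize A : 'M[R]_n := \matrix_(i, j) (A i j / \sum_k A k j).

(* The iterates after each single (row or column) normalization, from [M]
   itself at index 0; the first step normalizes rows. *)
Fixpoint sinkhorn M (k : nat) : 'M[R]_n :=
  if k is k'.+1 then
    if odd k' then col_normalize (sinkhorn M k')
    else row_normalize (sinkhorn M k')
  else M.

(* The limit is taken in the entrywise topology of ['M[R]_n].  [lim] is a total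
   operator; the value of [Phi] is meaningful on [calA], where the iteration
   converges by the Sinkhorn-Knopp theorem. *)
Definition Phi M : 'M[R]_n := lim (sinkhorn M k @[k --> \oo]).

Definition Phi_preimage L : set 'M[R]_n := [set M | calA M /\ Phi M = L].

Definition diag_prod A s : R := \prod_i A i (s i).

Definition cross_ratio_equiv A B : Prop :=
  (forall s, diag_prod A s != 0 <-> diag_prod B s != 0) /\
  (forall s t, positive_diag A s -> positive_diag A t ->
     diag_prod A s / diag_prod A t = diag_prod B s / diag_prod B t).

End Sinkhorn.

(* Main.v *)
(* Each normalization divides all diagonal products by one common factor, so
   the iteration preserves cross ratios.  After the first step the entries sum
   to n, hence by AM-GM the product of all line sums is at most 1: a positive
   diagonal product increases along the iteration and is at most 1, so it
   converges to a positive limit and the product of line sums tends to 1.  At a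
   cluster point AM-GM is an equality; thus cluster points are doubly stochastic
   and cross ratio equivalent to M.

   Two doubly stochastic cross ratio equivalent matrices A, B are equal: by
   Birkhoff, sum A_ij (ln B_ij - ln A_ij) is the common value of
   ln d^B_s - ln d^A_s, and so is sum B_ij (ln B_ij - ln A_ij); subtracting,
   sum (B_ij - A_ij) (ln B_ij - ln A_ij) = 0 with nonnegative terms.  So the
   cluster point is unique and, by compactness, is the limit. *)
Require Import Defs.
From mathcomp Require Import all_boot all_order all_fingroup all_algebra.
From mathcomp Require Import all_classical all_reals all_analysis.
From mathcomp Require Import lra.
Import Order.TTheory GRing.Theory Num.Theory.
Import numFieldNormedType.Exports.
Local Open Scope classical_set_scope.
Local Open Scope ring_scope.

Set Implicit Arguments.
Unset Strict Implicit.

(** * Positive diagonals and Birkhoff's theorem *)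

(** The common sum [s] is left free because the induction behind Birkhoff's theorem subtracts
    multiples of permutation matrices, which lowers it. *)
Definition constant_line_sums (R : realType) n (A : 'M[R]_n) (s : R) : Prop :=
  [/\ forall i j, 0 <= A i j, forall i, \sum_j A i j = s
    & forall j, \sum_i A i j = s].

(* In the digraph with an edge i -> j when A i (t j) > 0, equality of the line
   sums makes the set reachable from i0 closed backwards too, so i0 lies on a
   simple cycle, along which t can be rotated. *)
Lemma augment_diag (R : realType) n (A : 'M[R]_n) s (t : 'S_n) i0 :
  constant_line_sums A s -> 0 < s ->
  exists t' : 'S_n, 0 < A i0 (t' i0) /\
    forall i, 0 < A i (t i) -> 0 < A i (t' i).
Proof.
move=> [A0 Ar Ac] s0.
pose e : rel 'I_n := [rel i j | 0 < A i (t j)].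
pose S := [set j | connect e i0 j]%SET.
have [k Ak] : exists k, 0 < A k (t i0).
  apply/existsP; apply: contraPT (Ac (t i0)).
  rewrite negb_exists => /forallP An; rewrite big1 => [/esym s00|i _].
    by rewrite s00 ltxx in s0.
  by apply/eqP; rewrite eq_le A0 andbT leNgt An.
have kS : k \in S.
  apply: contraLR Ak => kNS; rewrite -leNgt.
  (* Rows in [S] vanish outside the columns [t j] with [j] in [S], so this block carries all of
     [s *+ #|S|]. Those columns have the same total, which leaves 0 for the rows outside [S]. *)
  have rowS : \sum_(j in S) \sum_(i in S) A i (t j) = s *+ #|S|.
    rewrite exchange_big -sumr_const; apply: eq_bigr => i; rewrite inE => iS.
    rewrite -(Ar i) [RHS](reindex_inj (@perm_inj _ t)) /= [RHS](bigID (mem S)) /=.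
    rewrite [X in _ = _ + X]big1 ?addr0 // => j; rewrite inE => jNS.
    apply/eqP; rewrite eq_le A0 andbT leNgt; apply: contra jNS => eij.
    exact: connect_trans iS (connect1 eij).
  have colS : \sum_(j in S) \sum_i A i (t j) = s *+ #|S|.
    by rewrite -sumr_const; apply: eq_bigr => j _; rewrite Ac.
  have outS : \sum_(j in S) \sum_(i | i \notin S) A i (t j) = 0.
    apply: (@addrI _ (s *+ #|S|)); rewrite addr0 -{1}rowS -colS -big_split.
    by apply: eq_bigr => j _; rewrite [RHS](bigID (mem S)).
  rewrite -outS (bigD1 i0) ?inE ?connect0 //= (bigD1 k) //= -addrA.
  by rewrite lerDl addr_ge0 ?sumr_ge0 // => j _; rewrite sumr_ge0.
move: kS; rewrite inE => /connectP[_ /shortenP[p pth up _] kE].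
pose c := i0 :: p.
have cyc : path.cycle e c by rewrite /= rcons_path pth -kE.
exists (perm (can_inj (prev_next up)) * t)%g.
have pos i : i \in c -> 0 < A i (t (next c i)) by apply: next_cycle cyc.
split=> [|i Ai]; rewrite permM permE; first by rewrite pos ?mem_head.
(* [next c] fixes every index off the cycle, so the new permutation agrees with [t] there. *)
have [/pos//|iNc] := boolP (i \in c).
by rewrite next_nth (negPf iNc).
Qed.

(** Augmenting at each index in turn suffices, since positions already positive stay positive; the
    start is the identity. *)
Lemma exists_positive_diag (R : realType) n (A : 'M[R]_n) s :
  constant_line_sums A s -> 0 < s -> exists t, positive_diag A t.
Proof.
move=> As s0; suff /(_ (enum 'I_n))[t At] : forall r : seq 'I_n,
    exists t : 'S_n, forall i, i \in r -> 0 < A i (t i).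
  by exists t => i; apply: At; rewrite mem_enum.
elim=> [|i r [t At]]; first by exists 1%g.
have [u [Aui Au]] := augment_diag t i As s0.
by exists u => j; rewrite inE => /predU1P[->//|/At/Au].
Qed.

(* Dual form of Birkhoff's theorem: a linear functional that is constant on
   the diagonals of the support takes that value on the matrix itself. *)
Lemma constant_line_sums_linear (R : realType) n (A : 'M[R]_n) s c
    (phi : 'I_n -> 'I_n -> R) :
  constant_line_sums A s -> 0 <= s ->
  (forall t, positive_diag A t -> \sum_i phi i (t i) = c) ->
  \sum_i \sum_j A i j * phi i j = s * c.
Proof.
pose supp (B : 'M[R]_n) := [set p | B p.1 p.2 != 0]%SET.
have [k leAk] := ubnP #|supp A|; elim: k => // k IH in A s leAk *.
move=> As s_ge0 phic; have [A0 Ar Ac] := As.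
have [s0|sn0] := eqVneq s 0.
  rewrite s0 mul0r big1 // => i _; rewrite big1 // => j _.
  have /eqP := Ar i; rewrite s0 psumr_eq0 // => /allP/(_ j).
  by rewrite mem_index_enum => /(_ isT)/eqP->; rewrite mul0r.
have s_gt0 : 0 < s by rewrite lt_neqAle eq_sym sn0.
have [t At] := exists_positive_diag As s_gt0.
have [i0 _|no_i] := pickP 'I_n; last first.
  rewrite -(phic t At) !big1 ?mulr0 // => i; by have := no_i i.
(* Subtracting the smallest diagonal entry times the permutation matrix of [t] keeps all entries
   non-negative and kills position [(i1, t i1)], so the support shrinks strictly. *)
pose i1 := [arg min_(i < i0) A i (t i)]%O.
have i1min i : A i1 (t i1) <= A i (t i).
  by rewrite /i1; case: Order.TotalTheory.arg_minP => // j _; apply.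
set m := A i1 (t i1) in i1min.
pose B := \matrix_(i, j) (A i j - m *+ (t i == j)).
have BA i j : B i j <= A i j.
  by rewrite mxE gerBl mulrn_wge0 // ltW ?At.
have B0 i j : 0 <= B i j.
  by rewrite mxE subr_ge0; case: eqP => [<-|_]; rewrite ?mulr1n ?mulr0n.
have Bs : constant_line_sums B (s - m).
  split=> // [i|j]; under eq_bigr do rewrite mxE; rewrite sumrB ?Ar ?Ac.
    congr (_ - _); rewrite (bigD1 (t i)) //= eqxx big1 ?addr0 // => j.
    by rewrite eq_sym => /negPf->.
  congr (_ - _); rewrite (bigD1 (t^-1 j)%g) //= permKV eqxx big1 ?addr0 // => i.
  by rewrite (canF_eq (permK t)) => /negPf->.
have suppB : (#|supp B| < k)%N.
  rewrite -ltnS; apply: leq_trans leAk; rewrite ltnS; apply: proper_card.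
  apply/properP; split.
    apply/fintype.subsetP => -[i j]; rewrite !inE /=; apply: contraNN.
    by move=> /eqP Aij0; rewrite eq_le B0 andbT -Aij0 BA.
  by exists (i1, t i1); rewrite inE /= ?mxE ?eqxx ?subrr ?eqxx // gt_eqF ?At.
have sm0 : 0 <= s - m by have [_ /(_ i0)<- _] := Bs; apply: sumr_ge0.
have := IH B _ suppB Bs sm0.
have -> : \sum_i \sum_j B i j * phi i j = \sum_i \sum_j A i j * phi i j - m * c.
  rewrite -(phic t At) mulr_sumr -sumrB; apply: eq_bigr => i _.
  under eq_bigr do rewrite mxE mulrBl; rewrite sumrB; congr (_ - _).
  rewrite (bigD1 (t i)) //= eqxx mulr1n big1 ?addr0 // => j.
  by rewrite eq_sym => /negPf->; rewrite mul0r.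
rewrite mulrBl => /(_ _)/addIr; apply => u Bu; apply: phic => i.
exact: lt_le_trans (Bu i) (BA _ _).
Qed.

(** Birkhoff tested on the indicator of [(i, j)]: if no positive diagonal passed through it, the
    functional would be 0 on all of them, forcing [A i j = 0]. *)
Lemma constant_line_sums_total_support (R : realType) n (A : 'M[R]_n) s i j :
  constant_line_sums A s -> 0 <= s -> 0 < A i j ->
  exists2 t, positive_diag A t & t i = j.
Proof.
move=> As s0; apply: contraPP => not_diag; apply/negP; rewrite -leNgt.
pose phi a b : R := ((a == i) && (b == j))%:R.
have := @constant_line_sums_linear _ _ A s 0 phi As s0.
rewrite mulr0 (bigD1 i) //= (bigD1 j) //= /phi !eqxx mulr1.
rewrite big1 ?addr0 => [|b /negPf->]; last by rewrite andbF mulr0.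
rewrite big1 ?addr0 => [-> //|a /negPf ai]; last first.
  by rewrite big1 // => b _; rewrite ai mulr0.
move=> t At; rewrite big1 // => a _; case: eqP => //= ->; case: eqP => // tij.
by case: not_diag; exists t.
Qed.

(** * Cross ratio equivalence and uniqueness among doubly stochastic matrices *)

Lemma ln_prod (R : realType) (I : Type) (r : seq I) (F : I -> R) :
  (forall i, 0 < F i) -> ln (\prod_(i <- r) F i) = \sum_(i <- r) ln (F i).
Proof.
move=> F0; elim: r => [|i r IH]; first by rewrite !big_nil ln1.
by rewrite !big_cons lnM ?IH // posrE // prodr_gt0.
Qed.

Lemma diag_prod_neq0 (R : realType) n (A : 'M[R]_n) s :
  (forall i j, 0 <= A i j) -> diag_prod A s != 0 <-> positive_diag A s.
Proof.
move=> A0; split=> [/prodf_neq0 h i|h]; first by rewrite lt0r A0 andbT h.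
by apply/prodf_neq0 => i _; rewrite gt_eqF.
Qed.

Lemma diag_prod_gt0 (R : realType) n (A : 'M[R]_n) s :
  positive_diag A s -> 0 < diag_prod A s.
Proof. by move=> As; apply: prodr_gt0. Qed.

Lemma cross_ratio_equiv_sym (R : realType) n (A B : 'M[R]_n) :
  (forall i j, 0 <= A i j) -> (forall i j, 0 <= B i j) ->
  cross_ratio_equiv A B -> cross_ratio_equiv B A.
Proof.
move=> A0 B0 [ABd ABr]; split=> [s|s t Bs Bt]; first by split=> /ABd.
by rewrite ABr //; apply/diag_prod_neq0 => //; apply/ABd/diag_prod_neq0.
Qed.

Lemma cross_ratio_equiv_trans (R : realType) n (A B C : 'M[R]_n) :
  (forall i j, 0 <= A i j) -> (forall i j, 0 <= B i j) ->
  cross_ratio_equiv A B -> cross_ratio_equiv B C -> cross_ratio_equiv A C.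
Proof.
move=> A0 B0 [ABd ABr] [BCd BCr]; split=> [s|s t As At].
  by split=> [/ABd/BCd|/BCd/ABd].
by rewrite ABr // BCr //; apply/diag_prod_neq0 => //; apply/ABd/diag_prod_neq0.
Qed.

Lemma calB_constant_line_sums (R : realType) n (A : 'M[R]_n) :
  calB A -> constant_line_sums A 1.
Proof. by case=> -[]. Qed.

Lemma calB_cross_ratio_eq (R : realType) n (A B : 'M[R]_n) :
  calB A -> calB B -> cross_ratio_equiv A B -> A = B.
Proof.
move=> /calB_constant_line_sums As /calB_constant_line_sums Bs AB.
have [[A0 _ _] [B0 _ _]] := (As, Bs).
have diagAB s : positive_diag A s <-> positive_diag B s.
  by split=> /diag_prod_neq0-/(_ ltac:(done))/AB.1/diag_prod_neq0; apply.
(* Total support upgrades agreement of positive diagonals to agreement of supports. *)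
have suppAB i j : (0 < A i j) = (0 < B i j).
  apply/idP/idP => [/(constant_line_sums_total_support As ler01)|
      /(constant_line_sums_total_support Bs ler01)] [t] /diagAB ht <-; exact: ht.
have [s0 As0] := exists_positive_diag As ltr01.
have Bs0 := (diagAB s0).1 As0.
pose phi i j := ln (B i j) - ln (A i j).
pose c := ln (diag_prod B s0) - ln (diag_prod A s0).
have phiA t : positive_diag A t -> \sum_i phi i (t i) = c.
  move=> At; have Bt := (diagAB t).1 At.
  rewrite sumrB -!ln_prod // -!/(diag_prod _ _) /c.
  have := congr1 (@ln R) (AB.2 _ _ At As0).
  rewrite !ln_div ?posrE ?diag_prod_gt0 // => ?; lra.
have phiB t : positive_diag B t -> \sum_i phi i (t i) = c by move/diagAB/phiA.
have := constant_line_sums_linear Bs ler01 phiB.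
rewrite -(constant_line_sums_linear As ler01 phiA) => /eqP.
rewrite -subr_eq0 -sumrB.
under eq_bigr do rewrite -sumrB; under eq_bigr do under eq_bigr do rewrite -mulrBl.
(* [ln] is increasing, so the two factors agree in sign; off the common support the first factor is
   0, whatever [ln] returns at 0. *)
have term_ge0 i j : 0 <= (B i j - A i j) * phi i j.
  have [Aij|] := boolP (0 < A i j); last first.
    move=> nA; have nB := nA; rewrite suppAB in nB.
    move: nA nB; rewrite -!leNgt => nA nB.
    by rewrite (@le_anti _ _ (A i j) 0) ?nA ?A0 // (@le_anti _ _ (B i j) 0)
      ?nB ?B0 // subrr mul0r.
  have Bij : 0 < B i j by rewrite -suppAB.
  have [le_AB|/ltW le_BA] := leP (A i j) (B i j).
    by rewrite mulr_ge0 ?subr_ge0 ?ler_ln ?posrE.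
  by rewrite mulr_le0 ?subr_le0 ?ler_ln ?posrE.
rewrite psumr_eq0 => [/allP sum0|i _]; last exact: sumr_ge0.
apply/matrixP => i j.
have := sum0 i (mem_index_enum i); rewrite psumr_eq0 => // /allP.
move=> /(_ j (mem_index_enum j)); rewrite /= mulf_eq0 !subr_eq0.
have [Aij|nA] := boolP (0 < A i j).
  have Bij : 0 < B i j by rewrite -suppAB.
  by move=> /orP[/eqP->//|/eqP/ln_inj]; rewrite !posrE => ->.
have nB := nA; rewrite suppAB in nB.
move: nA nB; rewrite -!leNgt => nA nB _.
by apply: (@le_anti _ _ _ _); rewrite (le_trans nA) ?(le_trans nB) ?A0 ?B0.
Qed.

(** * Cluster points and compactness for matrices *)

(** [f p] is a cluster point of the image filter, and in a Hausdorff space a convergent filter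
    clusters only at its limit. *)
Lemma cluster_cvg_eq (R : realType) (T : topologicalType) (F : set_system T)
    (f : T -> R) p l :
  cluster F p -> {for p, continuous f} -> f x @[x --> F] --> l -> f p = l.
Proof.
move=> Fp fp /cvg_cluster fl; apply/esym/(@norm_hausdorff _ R^o)/fl.
by move=> A B FA /fp nB; have [x [Ax Bx]] := Fp _ _ FA nB; exists (f x).
Qed.

Lemma cluster_ge (R : realType) (T : topologicalType) (F : set_system T)
    (f : T -> R) p a :
  cluster F p -> {for p, continuous f} -> (\forall x \near F, a <= f x) ->
  a <= f p.
Proof.
move=> Fp fp Fa; rewrite leNgt; apply/negP => fpa.
have [x [/= ax]] := Fp _ _ Fa (cvgr_lt _ fp a fpa).
by rewrite ltNge ax.
Qed.

Lemma cvg_mx (R : realType) m n (T : Type) (F : set_system T) {FF : Filter F}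
    (f : T -> 'M[R]_(m, n)) (l : 'M[R]_(m, n)) :
  (forall i j, f x i j @[x --> F] --> l i j) -> f x @[x --> F] --> l.
Proof.
move=> fl A [P Pl /filterS]; apply; apply: filter_forall => i.
by apply: filter_forall => j; exact: fl (Pl i j).
Qed.

Lemma vec_mx_continuous (R : realType) m n :
  continuous (@vec_mx R m n).
Proof.
move=> v; apply: (@cvg_mx _ _ _ _ (nbhs v)) => i j; under eq_fun do rewrite mxE; rewrite mxE.
exact: coord_continuous.
Qed.

(** The matrix box is the continuous image under [vec_mx] of a compact box of row vectors. *)
Lemma mx_itv_compact (R : realType) m n (a b : R) :
  compact [set A : 'M[R]_(m, n) | forall i j, a <= A i j <= b].
Proof.
have rVK : compact [set v : 'rV[R]_(m * n) |
    forall k, [set x | a <= x <= b] (v ord0 k)].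
  apply: (@rV_compact R _ (fun=> [set x | a <= x <= b])) => _.
  exact: (@segment_compact R a b).
suff -> : [set A : 'M[R]_(m, n) | forall i j, a <= A i j <= b] =
    [set vec_mx v | v in [set v : 'rV[R]_(m * n) |
      forall k, [set x | a <= x <= b] (v ord0 k)]].
  apply: continuous_compact rVK; apply: continuous_subspaceT.
  exact: vec_mx_continuous.
apply/seteqP; split=> [A Aab|_ [v vab <-] i j /=]; last by rewrite mxE; apply: vab.
by exists (mxvec A) => [k|]; rewrite ?mxvecK //; case/mxvec_indexP: k => i j;
  rewrite /= mxvecE.
Qed.

(** * AM-GM for line sums *)

Lemma prod_le1_sum_card (R : realType) n (E : 'I_n -> R) :
  (forall i, 0 <= E i) -> \sum_i E i = n%:R ->
  \prod_i E i <= 1 /\ (\prod_i E i = 1 -> forall i, E i = 1).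
Proof.
case: n E => [|n] E E0 Es; first by rewrite big_ord0; split=> // _ [].
have [] := @leif_AGM R _ predT E (fun i _ => E0 i).
rewrite card_ord Es divff ?pnatr_eq0 // expr1n => le1 eq1; split=> // Ep i.
move: eq1; rewrite Ep eqxx => /esym /forallP Eeq.
have {}Eeq j : E j = E i by have /forallP/(_ i)/eqP := implyP (Eeq j) isT.
move: Es; under eq_bigr do rewrite Eeq.
rewrite sumr_const card_ord -(mulr_natr (E i)) -[RHS]mul1r => /mulIf; apply.
by rewrite pnatr_eq0.
Qed.

(** The progress measure: once rows or columns are normalized, normalizing the other lines divides
    every diagonal product by exactly this number. *)
Definition line_prod (R : realType) n (A : 'M[R]_n) : R :=
  (\prod_i \sum_j A i j) * \prod_j \sum_i A i j.

Lemma line_prod_le1 (R : realType) n (A : 'M[R]_n) :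
  (forall i j, 0 <= A i j) -> \sum_i \sum_j A i j = n%:R ->
  line_prod A <= 1 /\ (line_prod A = 1 -> constant_line_sums A 1).
Proof.
move=> A0 An.
have r0 i : 0 <= \sum_j A i j by apply: sumr_ge0.
have c0 j : 0 <= \sum_i A i j by apply: sumr_ge0.
have [r1 rE] := prod_le1_sum_card r0 An.
rewrite exchange_big in An.
have [c1 cE] := prod_le1_sum_card c0 An.
have pr0 : 0 <= \prod_i \sum_j A i j by apply: prodr_ge0.
have pc0 : 0 <= \prod_j \sum_i A i j by apply: prodr_ge0.
rewrite /line_prod; split=> [|rc1]; first exact: mulr_ile1.
by split=> //; [apply: rE|apply: cE]; nra.
Qed.

(** * Effect of a single normalization *)

(** The invariant of the iteration: it makes every line sum positive, so no normalization divides by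
    0. *)
Definition nonneg_diag (R : realType) n (s : 'S_n) (A : 'M[R]_n) : Prop :=
  (forall i j, 0 <= A i j) /\ positive_diag A s.

Lemma row_sum_gt0 (R : realType) n (A : 'M[R]_n) s i :
  nonneg_diag s A -> 0 < \sum_j A i j.
Proof.
move=> [A0 As]; rewrite (bigD1 (s i)) //=.
by rewrite (lt_le_trans (As i)) // lerDl sumr_ge0.
Qed.

Lemma col_sum_gt0 (R : realType) n (A : 'M[R]_n) s j :
  nonneg_diag s A -> 0 < \sum_i A i j.
Proof.
move=> [A0 As]; have := As (s^-1 j)%g; rewrite permKV => Aj.
by rewrite (bigD1 (s^-1 j)%g) //= (lt_le_trans Aj) // lerDl sumr_ge0.
Qed.

Lemma nonneg_diag_row_normalize (R : realType) n (A : 'M[R]_n) s :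
  nonneg_diag s A -> nonneg_diag s (row_normalize A).
Proof.
move=> As; have r0 i := row_sum_gt0 i As; have [A0 Ap] := As.
by split=> [i j|i]; rewrite mxE; [rewrite divr_ge0 // ltW|rewrite divr_gt0].
Qed.

Lemma nonneg_diag_col_normalize (R : realType) n (A : 'M[R]_n) s :
  nonneg_diag s A -> nonneg_diag s (col_normalize A).
Proof.
move=> As; have c0 i := col_sum_gt0 i As; have [A0 Ap] := As.
by split=> [i j|i]; rewrite mxE; [rewrite divr_ge0 // ltW|rewrite divr_gt0].
Qed.

Lemma diag_prod_row_normalize (R : realType) n (A : 'M[R]_n) t :
  diag_prod (row_normalize A) t = diag_prod A t / \prod_i \sum_j A i j.
Proof.
by rewrite /diag_prod -prodf_div; apply: eq_bigr => i _; rewrite mxE.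
Qed.

Lemma diag_prod_col_normalize (R : realType) n (A : 'M[R]_n) t :
  diag_prod (col_normalize A) t = diag_prod A t / \prod_j \sum_i A i j.
Proof.
rewrite /diag_prod [X in _ / X](reindex_inj (@perm_inj _ t)) -prodf_div.
by apply: eq_bigr => i _; rewrite mxE.
Qed.

Lemma row_normalize_sum (R : realType) n (A : 'M[R]_n) s i :
  nonneg_diag s A -> \sum_j row_normalize A i j = 1.
Proof.
move=> As; under eq_bigr do rewrite mxE.
by rewrite -mulr_suml divff // gt_eqF // (row_sum_gt0 _ As).
Qed.

Lemma col_normalize_sum (R : realType) n (A : 'M[R]_n) s j :
  nonneg_diag s A -> \sum_i col_normalize A i j = 1.
Proof.
move=> As; under eq_bigr do rewrite mxE.
by rewrite -mulr_suml divff // gt_eqF // (col_sum_gt0 _ As).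
Qed.

Lemma diag_prod_continuous (R : realType) n (t : 'S_n) :
  continuous (fun A : 'M[R]_n => diag_prod A t).
Proof.
rewrite /diag_prod; apply: continuous_big => [|i _]; first exact: mul_continuous.
exact: coord_continuous.
Qed.

Lemma total_sum_continuous (R : realType) n :
  continuous (fun A : 'M[R]_n => \sum_i \sum_j A i j).
Proof.
apply: continuous_big => [|i _]; first exact: add_continuous.
apply: continuous_big => [|j _]; first exact: add_continuous.
exact: coord_continuous.
Qed.

Lemma line_prod_continuous (R : realType) n : continuous (@line_prod R n).
Proof.
have rows : continuous (fun A : 'M[R]_n => \prod_i \sum_j A i j).
  apply: continuous_big => [|i _]; first exact: mul_continuous.
  apply: continuous_big => [|j _]; first exact: add_continuous.
  exact: coord_continuous.
have cols : continuous (fun A : 'M[R]_n => \prod_j \sum_i A i j).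
  apply: continuous_big => [|j _]; first exact: mul_continuous.
  apply: continuous_big => [|i _]; first exact: add_continuous.
  exact: coord_continuous.
by move=> A; exact: cvgM (rows A) (cols A).
Qed.

(** * Convergence of the iteration *)

Section SinkhornConvergence.
Context {R : realType} {n : nat} (M : 'M[R]_n) (s : 'S_n) (Ms : nonneg_diag s M).

(** The shift skips [M] itself: from here on the rows ([k] even) or the columns ([k] odd) sum to 1,
    so the entries total [n]. *)
Let X k := sinkhorn M k.+1.

Lemma sinkhorn_nonneg_diag k : nonneg_diag s (sinkhorn M k).
Proof.
elim: k => //= k IH; case: odd; first exact: nonneg_diag_col_normalize.
exact: nonneg_diag_row_normalize.
Qed.

Lemma sinkhorn_ge0 k i j : 0 <= sinkhorn M k i j.
Proof. by have [] := sinkhorn_nonneg_diag k. Qed.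

Lemma sinkhorn_line_sums k :
  if odd k then forall j, \sum_i X k i j = 1 else forall i, \sum_j X k i j = 1.
Proof.
rewrite /X /=; case: odd => i.
  exact: col_normalize_sum (sinkhorn_nonneg_diag k).
exact: row_normalize_sum (sinkhorn_nonneg_diag k).
Qed.

Lemma sinkhorn_total_sum k : \sum_i \sum_j X k i j = n%:R.
Proof.
have := sinkhorn_line_sums k; case: odd => X1; first rewrite exchange_big.
  by under eq_bigr do rewrite X1; rewrite sumr_const card_ord.
by under eq_bigr do rewrite X1; rewrite sumr_const card_ord.
Qed.

Lemma sinkhorn_le1 k i j : X k i j <= 1.
Proof.
have := sinkhorn_line_sums k; case: odd => [/(_ j)|/(_ i)] <-.
  by rewrite (bigD1 i) //= lerDl sumr_ge0 // => *; apply: sinkhorn_ge0.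
by rewrite (bigD1 j) //= lerDl sumr_ge0 // => *; apply: sinkhorn_ge0.
Qed.

Lemma line_prod_sinkhorn_gt0 k : 0 < line_prod (sinkhorn M k).
Proof.
apply: mulr_gt0; apply: prodr_gt0 => i _.
  exact: row_sum_gt0 (sinkhorn_nonneg_diag k).
exact: col_sum_gt0 (sinkhorn_nonneg_diag k).
Qed.

(* The lines that are already normalized contribute a factor 1 to
   [line_prod]. *)
Lemma diag_prod_sinkhornS k t :
  diag_prod (X k.+1) t = diag_prod (X k) t / line_prod (X k).
Proof.
have -> : X k.+1 = if odd k then row_normalize (X k) else col_normalize (X k).
  by rewrite {1}/X [LHS]/= -if_neg negbK.
have := sinkhorn_line_sums k; rewrite /line_prod; case: (odd k) => X1.
  rewrite diag_prod_row_normalize; congr (_ / _).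
  by rewrite [Y in _ * Y]big1 ?mulr1.
by rewrite diag_prod_col_normalize [Y in _ / (Y * _)]big1 ?mul1r.
Qed.

(** Each step divides both sides by the same factor. The cross-multiplied form also covers diagonals
    with product 0. *)
Lemma diag_prod_sinkhorn_cross k t :
  diag_prod (sinkhorn M k) t * diag_prod M s =
  diag_prod (sinkhorn M k) s * diag_prod M t.
Proof.
elim: k => [|k IH]; first by rewrite mulrC.
rewrite /=; case: odd; rewrite ?(diag_prod_col_normalize,
  diag_prod_row_normalize) mulrAC IH; exact: mulrAC.
Qed.

Lemma diag_prod_sinkhorn_cvg :
  exists2 l : R, 0 < l & diag_prod (X k) s @[k --> \oo] --> l.
Proof.
pose u k := diag_prod (X k) s.
have u_gt0 k : 0 < u k by apply/diag_prod_gt0; have [] := sinkhorn_nonneg_diag k.+1.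
have u_nd : nondecreasing_seq u.
  apply/nondecreasing_seqP => k.
  rewrite /u diag_prod_sinkhornS ler_pdivlMr ?line_prod_sinkhorn_gt0 //.
  rewrite ger_pMr; last exact: u_gt0.
  by have [] := line_prod_le1 (sinkhorn_ge0 _) (sinkhorn_total_sum k).
have u_cvg : cvgn u.
  apply: (nondecreasing_is_cvgn u_nd); exists 1 => _ [k _ <-].
  by apply: prodr_ile1 => i _; rewrite sinkhorn_ge0 sinkhorn_le1.
exists (limn u) => //; apply: lt_le_trans (u_gt0 0%N) _.
exact: nondecreasing_cvgn_le.
Qed.

(** [line_prod (X k)] is the quotient of consecutive terms of a sequence with nonzero limit. *)
Lemma line_prod_sinkhorn_cvg : line_prod (X k) @[k --> \oo] --> (1 : R).
Proof.
have [l l_gt0 ul] := diag_prod_sinkhorn_cvg.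
have uS_neq0 k : diag_prod (X k) s != 0.
  by rewrite gt_eqF // diag_prod_gt0 //; have [] := sinkhorn_nonneg_diag k.+1.
have -> : (fun k => line_prod (X k)) =
    (fun k => diag_prod (X k) s / diag_prod (X k.+1) s).
  apply/funext => k; rewrite diag_prod_sinkhornS invf_div mulrA mulrAC.
  by rewrite divff ?mul1r.
rewrite -(@divff _ l) ?gt_eqF //; apply: cvgM => //; apply: cvgV.
  by rewrite gt_eqF.
by rewrite (cvg_shiftS (fun k => diag_prod (X k) s)).
Qed.

(** Each property is read off a continuous function of the matrix whose bound or limit along the
    iterates is known. *)
Lemma sinkhorn_cluster (L : 'M[R]_n) :
  cluster (X k @[k --> \oo]) L -> calB L /\ cross_ratio_equiv M L.
Proof.
move=> XL; have [M0 Mp] := Ms.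
have L0 i j : 0 <= L i j.
  apply: (cluster_ge XL (@coord_continuous _ _ _ i j L)).
  suff : \forall k \near \oo, 0 <= X k i j by [].
  by apply: nearW => k; exact: sinkhorn_ge0.
have Ln : \sum_i \sum_j L i j = n%:R.
  apply: (cluster_cvg_eq XL (f := fun A : 'M[R]_n => \sum_i \sum_j A i j)).
    exact: total_sum_continuous.
  suff : \sum_i \sum_j X k i j @[k --> \oo] --> (n%:R : R) by [].
  under eq_fun do rewrite sinkhorn_total_sum.
  exact: cvg_cst.
have Ls : constant_line_sums L 1.
  have [_] := line_prod_le1 L0 Ln; apply.
  apply: (cluster_cvg_eq XL (f := @line_prod R n)).
    exact: line_prod_continuous.
  exact: line_prod_sinkhorn_cvg.
have [l l_gt0 ul] := diag_prod_sinkhorn_cvg.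
have Lsl : diag_prod L s = l.
  apply: (cluster_cvg_eq XL (f := fun A : 'M[R]_n => diag_prod A s)) ul.
  exact: diag_prod_continuous.
have Lcross t : diag_prod L t * diag_prod M s = l * diag_prod M t.
  apply/eqP; rewrite -Lsl -subr_eq0; apply/eqP.
  apply: (cluster_cvg_eq XL (f := fun A : 'M[R]_n =>
      diag_prod A t * diag_prod M s - diag_prod A s * diag_prod M t)).
    have dc u : diag_prod A u @[A --> L] --> diag_prod L u.
      exact: diag_prod_continuous.
    exact: cvgB (cvgM (dc t) (cvg_cst _)) (cvgM (dc s) (cvg_cst _)).
  suff : diag_prod (X k) t * diag_prod M s - diag_prod (X k) s * diag_prod M t
      @[k --> \oo] --> (0 : R) by [].
  under eq_fun do rewrite diag_prod_sinkhorn_cross subrr.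
  exact: cvg_cst.
have Ms0 : diag_prod M s != 0 by rewrite gt_eqF ?diag_prod_gt0.
(* One nonzero constant relates all diagonal products of [L] and [M], so zeros and ratios both
   agree. *)
have LM t : diag_prod L t = l / diag_prod M s * diag_prod M t.
  by rewrite mulrAC -Lcross mulfK.
have c0 : l / diag_prod M s != 0 by rewrite mulf_neq0 ?invr_neq0 // gt_eqF.
split; last first.
  split=> [t|t u _ _]; first by rewrite LM mulf_eq0 negb_or c0.
  by rewrite !LM -(mulf_div (l / diag_prod M s)) divff ?mul1r.
have [_ Lr Lc] := Ls; split=> //; split=> // i; apply: contrapT => Li0.
  have := Lr i; rewrite big1 => [/esym/eqP|j _]; first by rewrite oner_eq0.
  by apply: contrapT => /eqP Lij; apply: Li0; exists j.
have := Lc i; rewrite big1 => [/esym/eqP|j _]; first by rewrite oner_eq0.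
by apply: contrapT => /eqP Lij; apply: Li0; exists j.
Qed.

Lemma sinkhorn_cvg : exists L : 'M[R]_n,
  [/\ calB L, cross_ratio_equiv M L & sinkhorn M k @[k --> \oo] --> L].
Proof.
(* The bounds are wider than [[0, 1]] so that [V] is a neighbourhood of [L], as
   [compact_cluster_set1] requires. *)
pose V := [set A : 'M[R]_n | forall i j, -1 <= A i j <= 2].
have XV : (X k @[k --> \oo]) V.
  suff : \forall k \near \oo, V (X k) by [].
  apply: nearW => k i j; have := sinkhorn_le1 k i j.
  by have := sinkhorn_ge0 k.+1 i j; rewrite /X; lra.
have Vc : compact V by exact: mx_itv_compact.
have [L [_ XL]] := Vc _ _ XV.
have [LB ML] := sinkhorn_cluster XL.
exists L; split=> //; rewrite -cvg_shiftS.
apply: (compact_cluster_set1 _ Vc _ _ XV).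
- exact: norm_hausdorff.
- have [L0 Lr _] := calB_constant_line_sums LB.
  have L1 i j : L i j <= 1.
    by rewrite -(Lr i) (bigD1 j) //= lerDl sumr_ge0.
  exists (fun _ _ => [set x | x \in `]-1, 2[ ]) => [i j|A /= AV i j].
    by apply: near_in_itvoo; rewrite in_itv /=; have := L0 i j; have := L1 i j; lra.
  by have := AV i j; rewrite in_itv /=; lra.
apply/seteqP; split=> [K XK|_ -> //].
have [KB MK] := sinkhorn_cluster XK.
have [[M0 _] [K0 _ _]] := (Ms, calB_constant_line_sums KB).
apply: calB_cross_ratio_eq => //.
exact: cross_ratio_equiv_trans K0 M0 (cross_ratio_equiv_sym M0 K0 MK) ML.
Qed.

End SinkhornConvergence.

Theorem proposition19 (R : realType) (n : nat) (M L : 'M[R]_n)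
    (hM : calA M) (hL : calB L) :
  Phi_preimage L M <-> cross_ratio_equiv M L.
Proof.
have [[M0 _ _] [s Ms]] := hM.
have [K [KB MK /cvg_lim PhiK]] := sinkhorn_cvg (conj M0 Ms).
have {}PhiK : Phi M = K by apply: PhiK; exact: norm_hausdorff.
split=> [[_]|ML]; first by rewrite PhiK => <-.
(* The limit [K] and [L] are both doubly stochastic and equivalent to [M], so uniqueness identifies
   them. *)
split=> //; rewrite PhiK; apply: calB_cross_ratio_eq => //.
have [K0 _ _] := calB_constant_line_sums KB.
exact: cross_ratio_equiv_trans K0 M0 (cross_ratio_equiv_sym M0 K0 MK) ML.
Qed.
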